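(* Let $\Delta$ be a PR complex on vertex set $V$, with degree type of the form $(d_p,\dots,d_i,\underbrace{1,\dots,1}_{i-1})$ for some $p\ge i\ge1$. The complex $\widetilde\Delta=\phi_i(\Delta)$ on vertex set $V\sqcup S_\Delta^i$ is a PR complex with degree type $(d_p,\dots,d_i+1,\underbrace{1,\dots,1}_{i-1})$ (i.e. the entry $d_i$ is replaced by $d_i+1$ and all other entries are unchanged).
   Context: PR complexes: fix an arbitrary field $\mathbb{K}$. Simplicial complexes are finite and contain $\emptyset$; $\widetilde H_i(\Delta)$ denotes reduced simplicial homology with coefficients in $\mathbb{K}$, with $\widetilde H_{-1}(\{\emptyset\})=\mathbb{K}$. For $\sigma\in\Delta$, $\mathrm{link}_\Delta\sigma=\{\tau\in\Delta:\tau\cap\sigma=\emptyset,\ \tau\cup\sigma\in\Delta\}$. $\Delta$ is PR (over $\mathbb{K}$) if for every $i$ and all $\sigma,\tau\in\Delta$, $\widetilde H_i(\mathrm{link}_\Delta\sigma)\neq0\neq\widetilde H_i(\mathrm{link}_\Delta\tau)$ implies $|\sigma|=|\tau|$. Degree type: for a PR complex $\Delta$, let $p$ be the maximum index for which some face $\sigma$ has $\widetilde H_{p-1}(\mathrm{link}_\Delta\sigma)\neq0$; for $0\le i\le p$ let $s_i$ be the common size $|\sigma|$ of the faces $\sigma$ with $\widetilde H_{i-1}(\mathrm{link}_\Delta\sigma)\neq 0$ (such faces exist for each such $i$); for $1\le i\le p$ let $d_i=s_{i-1}-s_i$. The degree type of $\Delta$ is $(d_p,\dots,d_1)$. The operation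 $\phi_i$: let $\Delta$ be a simplicial complex on $V$ and $i$ a positive integer. Put $S_\Delta^i=\{u_\sigma:\sigma\in\Delta,\ |\sigma|\ge\dim\Delta+2-i\}$, a set of new vertices (here $\dim\Delta$ is the maximum of $|\sigma|-1$ over $\sigma\in\Delta$, and $\sigma=\emptyset$ is allowed). Then $\phi_i(\Delta)$ is the complex on $V\sqcup S_\Delta^i$ obtained by adding to $\Delta$ all faces $\sigma\sqcup\{u_{\tau_1},\dots,u_{\tau_r}\}$ for each sequence $\sigma\subseteq\tau_1\subset\dots\subset\tau_r$ of faces of $\Delta$ (the inclusions among the $\tau_j$ being strict) for which $u_{\tau_1},\dots,u_{\tau_r}\in S_\Delta^i$. *)

(* Defs.v *)
From HB Require Import structures.
From mathcomp Require Import all_boot all_order all_algebra.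

Set Implicit Arguments.
Unset Strict Implicit.
Unset Printing Implicit Defensive.

Import Order.TTheory GRing.Theory Num.Theory.
Local Open Scope ring_scope.

(** A complex on the vertex set [V] is a set of subsets of [V]. Elements of [V]
    need not themselves be faces. *)
Definition simplicial_complex (V : finType) (D : {set {set V}}) : Prop :=
  set0 \in D /\ (forall s t : {set V}, t \in D -> s \subset t -> s \in D).

Definition link (V : finType) (D : {set {set V}}) (s : {set V}) :
    {set {set V}} :=
  [set t in D | (t :&: s == set0) && (t :|: s \in D)].

Definition complex_dim (V : finType) (D : {set {set V}}) : int :=
  (\max_(s in D) #|s|)%:Z - 1.

Section Homology.
Variables (K : fieldType) (V : finType).
Implicit Types (D : {set {set V}}) (s : {set V}) (j : int).

(** The space of formal [K]-linear combinations of subsets of [V]; the chains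
    of a complex are the subspaces [chains D j] of this single space. *)
Definition chain_space := {ffun {set V} -> K^o}.

Definition basis_chain s : chain_space := [ffun t => (t == s)%:R].

(** Orientations come from the enumeration order of [V]: [vpos s x] is the
    number of vertices of [s] that precede [x]. *)
Definition vpos s (x : V) : nat :=
  #|[set y in s | (enum_rank y < enum_rank x)%N]|.

Definition boundary_fun (c : chain_space) : chain_space :=
  \sum_(s : {set V})
    (c s : K) *: \sum_(x in s) (-1) ^+ vpos s x *: basis_chain (s :\ x).

Fact boundary_fun_is_linear : linear boundary_fun.
Proof.
move=> a u v; rewrite /boundary_fun scaler_sumr -big_split /=.
by apply: eq_bigr => s _; rewrite !ffunE scalerDl scalerA.
Qed.

HB.instance Definition _ := GRing.isLinear.Build K chain_space chain_space _
  boundary_fun boundary_fun_is_linear.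

Definition boundary : 'End(chain_space) := linfun boundary_fun.

(** The face [set0] spans the chains of dimension -1, so the complex is the
    augmented one. *)
Definition chains D j : {vspace chain_space} :=
  <<[seq basis_chain s | s <- enum D & (#|s|%:Z == j + 1)%R]>>%VS.

Definition cycles D j : {vspace chain_space} := (chains D j :&: lker boundary)%VS.

Definition boundaries D j : {vspace chain_space} :=
  (boundary @: chains D (j + 1))%VS.

(** The quotient of cycles by boundaries, realised as a linear complement of
    the boundaries in the cycles. *)
Definition rhomology D j : {vspace chain_space} :=
  (cycles D j :\: boundaries D j)%VS.

Definition PR_complex D : Prop :=
  simplicial_complex D /\
  forall (j : int) (s t : {set V}), s \in D -> t \in D ->
    rhomology (link D s) j != 0%VS -> rhomology (link D t) j != 0%VS ->
    #|s| = #|t|.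

(** [ds] lists [d_p, ..., d_1] with [d_k = s_{k-1} - s_k]. For a PR complex
    [p] and [s_0, ..., s_p] are determined, so [ds] is unique. *)
Definition degree_type D (ds : seq int) : Prop :=
  exists (p : nat) (sz : nat -> nat),
  [/\ (exists2 s, s \in D & rhomology (link D s) (p%:Z - 1) != 0%VS),
      (forall (q : nat) s, s \in D ->
         rhomology (link D s) (q%:Z - 1) != 0%VS -> (q <= p)%N),
      (forall k : nat, (k <= p)%N ->
         (exists2 s, s \in D & rhomology (link D s) (k%:Z - 1) != 0%VS) /\
         (forall s, s \in D -> rhomology (link D s) (k%:Z - 1) != 0%VS ->
            #|s| = sz k))
    & ds = [seq (sz k.-1)%:Z - (sz k)%:Z | k <- rev (iota 1 p)]].

End Homology.

Section Phi.
Variables (V : finType) (i : nat) (D : {set {set V}}).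

Definition Sphi : {set {set V}} :=
  [set s in D | complex_dim D + 2 - i%:Z <= #|s|%:Z].

(** The new vertex [u_t] is [t] itself, viewed in this type. *)
Definition new_vertex := {t : {set V} | t \in Sphi}.

(** The strict sequence [t_1, ..., t_r] is given by its set of terms [T], which
    is a chain for inclusion; [phiP] restates this with sequences. The faces of
    [D] are the case where [T] is empty. *)
Definition phi : {set {set (V + new_vertex)}} :=
  [set F | [exists s in D, exists T : {set new_vertex},
     [&& [forall a in T, s \subset val a],
         [forall a in T, forall b in T,
            (val a \subset val b) || (val b \subset val a)]
       & F == [set inl x | x in s] :|: [set inr a | a in T]]]].

Lemma phiP (F : {set (V + new_vertex)}) :
  reflect
    (exists s (ts : seq new_vertex),
      [/\ s \in D,
          (if ts is t1 :: ts' then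
             (s \subset val t1) &&
             path (fun a b : new_vertex => val a \proper val b) t1 ts'
           else true)
        & F = [set inl x | x in s] :|: [set inr a | a in ts]])
    (F \in phi).
Proof.
pose lt := fun a b : new_vertex => val a \proper val b.
have lt_trans : transitive lt by move=> b a c; apply: proper_trans.
rewrite inE; apply: (iffP exists_inP) => [[s sD /existsP[T]]|[s [ts [sD tsP ->]]]].
  case/and3P=> /forall_inP sT /forall_inP chT /eqP ->.
  pose le := fun a b : new_vertex => val a \subset val b.
  have le_trans : transitive le by move=> b a c; apply: subset_trans.
  pose ts := sort le (enum T).
  have mts a : (a \in ts) = (a \in T) by rewrite mem_sort mem_enum.
  have srt : sorted le ts.
    apply: (sort_sorted_in (P := mem T)); last by apply/allP=> a; rewrite mem_enum.
    by move=> a b aT bT; have /forall_inP := chT _ aT; apply.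
  have lts : sorted lt ts.
    have uts : uniq ts by rewrite sort_uniq enum_uniq.
    have : sorted (fun a b => (a != b) && le a b) ts.
      rewrite sorted_pairwise; last first.
        move=> b a c /andP[ab leab] /andP[bc lebc].
        rewrite (le_trans _ _ _ leab lebc) andbT.
        apply: contra ab => /eqP ac; rewrite -ac in lebc.
        by apply/eqP/val_inj/eqP; rewrite eqEsubset; apply/andP.
      rewrite (pairwise_relI (fun a b => a != b) le) -uniq_pairwise uts.
      by rewrite -sorted_pairwise.
    apply: sub_sorted => a b /andP[ab leab].
    by rewrite /lt properEneq (inj_eq val_inj) ab.
  exists s, ts; split=> //.
    case E: ts lts mts => [//|t1 ts'] /= ->; rewrite andbT => mts.
    by apply: sT; rewrite -mts mem_head.
  congr (_ :|: _); apply/setP=> z.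
  by apply/imsetP/imsetP=> -[a aT ->]; exists a => //; rewrite mts in aT *.
exists s => //; apply/existsP; exists [set a in ts]; apply/and3P; split.
- apply/forall_inP=> a; rewrite inE; case: ts tsP => // t1 ts' /andP[st1 pth].
  rewrite inE => /predU1P[-> //|ats]; apply: subset_trans st1 (proper_sub _).
  by have /allP := order_path_min lt_trans pth; apply.
- apply/forall_inP=> a; rewrite inE => ats; apply/forall_inP=> b; rewrite inE => bts.
  have pw : pairwise lt ts.
    rewrite -sorted_pairwise //; by case: ts tsP {ats bts} => // t1 ts' /andP[].
  elim: ts pw ats bts {tsP} => //= c ts IH /andP[/allP ct pw].
  rewrite !inE => /predU1P[->|ats] /predU1P[->|bts].
  + by rewrite subxx.
  + by rewrite (proper_sub (ct _ bts)).
  + by rewrite (proper_sub (ct _ ats)) orbT.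
  + exact: IH.
- apply/eqP; congr (_ :|: _); apply/setP=> z.
  by apply/imsetP/imsetP=> -[a aT ->]; exists a => //; move: aT; rewrite inE.
Qed.

End Phi.

(* Main.v *)
From HB Require Import structures.
Require Import Defs.
From mathcomp Require Import all_boot all_order all_algebra.
From mathcomp Require Import zify.

(** Vertex removal controls the homology of every link in [phi i D]. Let [w] be
    a vertex of a complex [X]. If the link of [w] is acyclic, then [X] and its
    deletion [X - w] have the same homology; if [X - w] is acyclic, the homology
    of [X] is that of the link of [w] shifted by one; if [X] is acyclic, the link
    of [w] and [X - w] have the same homology.

    Write a face of [phi i D] as a pair [(s, T)], [s] a face of [D] and [T] a
    chain of new vertices, and call [s] large if [|s| >= dim D + 2 - i], that is
    [|s| >= s_{i-1}].
    - [s] small, [T] empty: removing all new vertices, each of which has an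
      acyclic link, shows that the link of [(s, T)] has the homology of the link
      of [s] in [D].
    - [s] small, [T] nonempty: the same removals lead to a cone, whose apex is a
      vertex of [min T] outside [s].
    - [s] large, [T] empty: removing the old vertices leads to a cone with apex
      [u_s].
    - [s] large, [T] nonempty: if [u_s] is not in [T], enlarging [s] by a vertex
      of [min T] shifts the homology by one; if [u_s] is in [T] and is not its
      only element, removing it from [T] shifts the homology by one the other
      way. This reduces to [T = {u_s}], where the link of [(s, T)] has the
      homology of the link of [s] in [D]. The latter sits in the top degree, since
      [|s| >= s_{i-1}] leaves only the sizes [s_q = s_0 - q] with [q < i].
    So the face sizes of [phi i D] are [s_q + 1] for [q < i] and [s_q] for
    [q >= i]. *)

Set Implicit Arguments.
Unset Strict Implicit.
Unset Printing Implicit Defensive.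

Import Order.TTheory GRing.Theory Num.Theory.
Local Open Scope ring_scope.

(** * Chains, cones and boundaries *)

Section Chains.
Variables (K : fieldType) (V : finType).
Local Notation chain := (chain_space K V).
Implicit Types (D : {set {set V}}) (c z : chain) (s t : {set V}) (j : int).

Lemma vposU1 t x y : x \notin t ->
  vpos (x |: t) y = (vpos t y + (enum_rank x < enum_rank y))%N.
Proof.
move=> xt; rewrite /vpos.
case: ltnP => lt_xy.
  rewrite addn1 -[RHS]/(1 + _)%N (_ : [set z in x |: t | _] =
    x |: [set z in t | (enum_rank z < enum_rank y)%N]); last first.
    by apply/setP=> z; rewrite !inE andb_orl; case: eqP => [->|//]; rewrite lt_xy.
  by rewrite cardsU1 inE (negPf xt).
rewrite addn0; congr #|pred_of_set _|; apply/setP=> z; rewrite !inE andb_orl.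
by case: eqP => [->|//]; rewrite ltnNge lt_xy andbF.
Qed.

Lemma scale_chainE (a : K) c t : (a *: c) t = a * (c t : K).
Proof. by rewrite ffunE. Qed.

(** Exchanging the sums leaves, for each [x] outside [t], the single face [x |: t] that loses [x] to
    become [t]. *)
Lemma boundaryE c t : boundary K V c t =
  \sum_(x | x \notin t) (-1) ^+ vpos t x * (c (x |: t) : K).
Proof.
rewrite lfunE /= /boundary_fun sum_ffunE.
transitivity (\sum_(s : {set V}) \sum_(x in s) (if s :\ x == t then
     (-1) ^+ vpos t x * (c (x |: t) : K) else 0)).
  apply: eq_bigr => s _; rewrite scale_chainE sum_ffunE mulr_sumr.
  apply: eq_bigr => x xs; rewrite scale_chainE ffunE [t == _]eq_sym.
  case: eqP => [<-|_]; last by rewrite !mulr0.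
  by rewrite setD1K // mulr1 mulrC -{1}(setD1K xs) vposU1 ?setD11 // ltnn addn0.
rewrite (exchange_big_dep predT) //= [RHS]big_mkcond /=; apply: eq_bigr => x _.
rewrite -big_mkcondr /=.
case: ifPn => [xt|/negPn xt].
  rewrite (big_pred1 (x |: t)) // => s; apply/andP/eqP => [[xs /eqP <-]|->].
    by rewrite setD1K.
  by rewrite setU11 setU1K.
rewrite big_pred0 // => s; apply/negP => /andP[_ /eqP E].
by rewrite -E setD11 in xt.
Qed.

(** Join with [w]; the sign puts [w] first in the orientation. Faces of [c] already containing [w]
    are killed. *)
Definition cone (w : V) c : chain :=
  [ffun t : {set V} => if w \in t then (-1) ^+ vpos t w * (c (t :\ w) : K) else 0].

Fact cone_is_linear w : linear (cone w).
Proof.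
move=> a u v; apply/ffunP=> t; rewrite !ffunE; case: ifP => _.
  by rewrite /GRing.scale /= mulrDr !mulrA [_ * a]mulrC.
by rewrite scaler0 addr0.
Qed.

HB.instance Definition _ w :=
  GRing.isLinear.Build K chain chain _ (cone w) (cone_is_linear w).

(** At a face without [w] only the coface through [w] contributes. At a face with [w], the term of
    [w] in the inner boundary returns [c t], and the remaining terms of the two sides agree up to
    one order swap. *)
Lemma boundary_cone w c : boundary K V (cone w c) = c - cone w (boundary K V c).
Proof.
apply/ffunP=> t; rewrite boundaryE !ffunE.
case: ifPn => wt; last first.
  rewrite subr0 (bigD1 w) //= big1 ?addr0 => [|x /andP[xt xw]].
    rewrite ffunE setU11 setU1K // vposU1 // ltnn addn0 mulrA -expr2.
    by rewrite sqrr_sign mul1r.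
  by rewrite ffunE !inE eq_sym (negPf xw) (negPf wt) mulr0.
have wt' : w \notin t :\ w by rewrite setD11.
have Et := setD1K wt.
rewrite boundaryE [in RHS](bigD1 w) //= Et mulrDr.
have -> : vpos t w = vpos (t :\ w) w by rewrite -{1}Et vposU1 // ltnn addn0.
rewrite mulrA -expr2 sqrr_sign mul1r opprD addNKr mulr_sumr -sumrN.
apply: eq_big => [x|x xt].
  by rewrite !inE negb_and negbK; case: eqP => [->|]; rewrite ?wt ?andbT ?andbF.
have xw : x != w by apply: contraNneq xt => ->.
have xt' : x \notin t :\ w by rewrite !inE (negPf xt) andbF.
rewrite ffunE !inE wt orbT vposU1 // -{1 2}Et !vposU1 // ltnn addn0.
have -> : (x |: t) :\ w = x |: t :\ w.
  by apply/setP=> y; rewrite !inE; case: (eqVneq y x) => [->|]; rewrite ?xw.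
rewrite !exprD !mulrA -!mulNr; congr (_ * _).
(* Exactly one of [x] and [w] precedes the other, which yields a single sign. *)
have : enum_rank x != enum_rank w :> nat.
  by apply: contra xw => /eqP /val_inj /enum_rank_inj ->.
by case: ltngtP => // _ _; rewrite ?expr0 ?expr1 ?mulr1 ?mul1r ?mulrN1 ?mulNr 1?mulrC.
Qed.

Lemma chainE c : c = \sum_s (c s : K) *: basis_chain K s.
Proof.
apply/ffunP=> t; rewrite sum_ffunE (bigD1 t) //= big1 ?addr0 => [|s st].
  by rewrite scale_chainE ffunE eqxx mulr1.
by rewrite scale_chainE ffunE eq_sym (negPf st) mulr0.
Qed.

Lemma memv_chains D j c : reflect
  (forall s, c s != 0 -> s \in D /\ #|s|%:Z = j + 1) (c \in chains K D j).
Proof.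
pose good s := (s \in D) && (#|s|%:Z == j + 1).
apply: (iffP idP) => [|H].
  rewrite -[chains _ _ _]/(<<in_tuple _>>%VS) => /coord_span -> s; rewrite sum_ffunE => nz.
  suff /andP[sD /eqP sj] : good s by [].
  apply: contraNT nz => ngs; rewrite big1 // => k _; rewrite scale_chainE.
  set X := [seq _ | _ <- _ & _]; have : X`_k \in X by rewrite mem_nth // size_tuple.
  case/mapP=> t; rewrite mem_filter mem_enum => /andP[tj tD] ->; rewrite ffunE.
  rewrite (_ : (s == t) = false) ?mulr0 //.
  by apply: contraNF ngs => /eqP ->; rewrite /good tD.
rewrite (chainE c); apply: memv_suml => s _.
have [->|/H[sD sj]] := eqVneq (c s) 0; first by rewrite scale0r mem0v.
apply/memvZ/memv_span/map_f; by rewrite mem_filter mem_enum sD sj eqxx.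
Qed.

Lemma rhomology_neq0P D j :
  reflect (exists z, [/\ z \in chains K D j, boundary K V z = 0 &
             forall y, y \in chains K D (j + 1) -> boundary K V y != z])
          (rhomology K D j != 0%VS).
Proof.
rewrite /rhomology diffv_eq0; apply: (iffP idP) => [/subvPn[z]|[z [zC z0 zb]]].
  rewrite memv_cap memv_ker => /andP[zC /eqP z0] zb; exists z; split=> // y yC.
  by apply: contraNneq zb => <-; rewrite memv_img.
apply/subvPn; exists z; first by rewrite memv_cap memv_ker zC z0 eqxx.
by apply/memv_imgP=> -[y yC E]; have := zb y yC; rewrite E eqxx.
Qed.

Definition acyclic D := forall j, rhomology K D j = 0%VS.

Lemma acyclicP D : acyclic D <-> forall j z, z \in chains K D j ->
  boundary K V z = 0 -> exists2 y, y \in chains K D (j + 1) & boundary K V y = z.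
Proof.
split=> [aD j z zC z0|H j]; last first.
  apply/eqP/negPn/rhomology_neq0P=> -[z [zC z0 zb]].
  by have [y yC E] := H j z zC z0; have := zb y yC; rewrite E eqxx.
have : z \in boundaries K D j.
  have /eqP := aD j; rewrite diffv_eq0 => /subvP; apply.
  by rewrite memv_cap memv_ker zC z0 eqxx.
by case/memv_imgP=> y yC ->; exists y.
Qed.

End Chains.

(** * Removing a vertex *)

(** The empty family is allowed, since the vertex link of a non-vertex is empty. *)
Definition down_closed (V : finType) (D : {set {set V}}) :=
  forall s t : {set V}, t \in D -> s \subset t -> s \in D.

Definition deletion (V : finType) (D : {set {set V}}) (w : V) :=
  [set s in D | w \notin s].

Definition vlink (V : finType) (D : {set {set V}}) (w : V) :=
  [set s : {set V} | (w \notin s) && (w |: s \in D)].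

Section VertexRemoval.
Variables (K : fieldType) (V : finType) (D : {set {set V}}) (w : V).
Hypothesis Ddown : down_closed D.
Local Notation chain := (chain_space K V).
Local Notation chains := (chains K).
Local Notation boundary := (boundary K V).
Implicit Types (a b c y z : chain) (s t : {set V}) (j : int).

Lemma chainsS (D1 D2 : {set {set V}}) j c : D1 \subset D2 -> c \in chains D1 j -> c \in chains D2 j.
Proof.
move=> /subsetP sD /memv_chains H; apply/memv_chains=> s /H[/sD]; by split.
Qed.

(** For chains [a], [b] free of [w], the decomposition [a + cone w b] is unique. *)
Definition off c := forall s, w \in s -> c s = 0.

Lemma off_chains c (D1 : {set {set V}}) j :
  {in D1, forall s, w \notin s} -> c \in chains D1 j -> off c.
Proof.
move=> wD /memv_chains H s ws; apply/eqP/negPn/negP=> /H[/wD]; by rewrite ws.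
Qed.

Lemma off_boundary c : off c -> off (boundary c).
Proof.
move=> oc s ws; rewrite boundaryE big1 // => x _.
by rewrite oc ?mulr0 // !inE ws orbT.
Qed.

Lemma coneE c s : w \notin s -> cone w c (w |: s) = (-1) ^+ vpos s w * (c s : K).
Proof. by move=> ws; rewrite ffunE setU11 setU1K // vposU1 // ltnn addn0. Qed.

Lemma cone_split_eq a b a' b' : off a -> off b -> off a' -> off b' ->
  a + cone w b = a' + cone w b' -> a = a' /\ b = b'.
Proof.
move=> oa ob oa' ob' E; split; apply/ffunP=> s.
  have [ws|ws] := boolP (w \in s); first by rewrite oa ?oa'.
  by have /ffunP/(_ s) := E; rewrite !ffunE (negPf ws) !addr0.
have [ws|ws] := boolP (w \in s); first by rewrite ob ?ob'.
have /ffunP/(_ (w |: s)) := E.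
have addE (u v : chain) t : (u + v) t = u t + v t by rewrite ffunE.
rewrite !addE !coneE // oa ?oa' ?setU11 // !add0r.
by apply: mulfI; rewrite signr_eq0.
Qed.

Lemma cone_chains j c : c \in chains (vlink D w) j -> cone w c \in chains D (j + 1).
Proof.
move=> /memv_chains H; apply/memv_chains=> s; rewrite ffunE; case: ifP => [ws|]; last first.
  by rewrite eqxx.
rewrite mulf_eq0 signr_eq0 /= => /H[]; rewrite inE setD1K // => /andP[_ sD].
by rewrite [#|s|](cardsD1 w) ws => E; split=> //; lia.
Qed.

Lemma vlink_off : {in vlink D w, forall s, w \notin s}.
Proof. by move=> s; rewrite inE => /andP[]. Qed.

Lemma deletion_off : {in deletion D w, forall s, w \notin s}.
Proof. by move=> s; rewrite inE => /andP[]. Qed.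

Lemma deletion_sub : deletion D w \subset D.
Proof. by apply/subsetP=> s; rewrite inE => /andP[]. Qed.

Lemma vlink_sub : vlink D w \subset deletion D w.
Proof.
by apply/subsetP=> s; rewrite !inE => /andP[-> wD]; rewrite andbT (Ddown wD) ?subsetUr.
Qed.

Let off_vlink c j := @off_chains c _ j vlink_off.
Let off_deletion c j := @off_chains c _ j deletion_off.

(** Faces without [w] give [a]; faces with [w], stripped of it, give [b], with a sign that [cone]
    undoes. *)
Lemma chain_split j c : c \in chains D (j + 1) -> exists a b,
  [/\ a \in chains (deletion D w) (j + 1), b \in chains (vlink D w) j & c = a + cone w b].
Proof.
move=> /memv_chains H.
exists [ffun s : {set V} => if w \in s then 0 else c s].
exists [ffun s : {set V} => if w \in s then 0 else (-1) ^+ vpos s w * (c (w |: s) : K)].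
split.
- apply/memv_chains=> s; rewrite ffunE; case: ifPn; rewrite ?eqxx // => ws /H[sD E].
  by rewrite inE sD ws.
- apply/memv_chains=> s; rewrite ffunE; case: ifPn; rewrite ?eqxx // => ws.
  rewrite mulf_eq0 signr_eq0 /= => /H[sD]; rewrite cardsU1 ws inE ws sD => E.
  by split=> //; lia.
apply/ffunP=> s; rewrite !ffunE; case: ifPn => ws; last by rewrite addr0.
by rewrite add0r setD11 setD1K // -{2}(setD1K ws) vposU1 ?setD11 // ltnn addn0 mulrA
           -expr2 sqrr_sign mul1r.
Qed.

Lemma boundary_split a b : boundary (a + cone w b) = (boundary a + b) + cone w (- boundary b).
Proof. by rewrite linearD /= boundary_cone linearN addrA. Qed.

Lemma offD a b : off a -> off b -> off (a + b).
Proof. by move=> oa ob s ws; rewrite ffunE oa ?ob ?addr0. Qed.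

Lemma offN a : off a -> off (- a).
Proof. by move=> oa s ws; rewrite ffunE oa ?oppr0. Qed.

Lemma boundary_split_eq a b a' b' : off a -> off b -> off a' -> off b' ->
  boundary (a + cone w b) = a' + cone w b' ->
  a' = boundary a + b /\ b' = - boundary b.
Proof.
move=> oa ob oa' ob'; rewrite boundary_split => E.
by have [-> ->] :=
  cone_split_eq (offD (off_boundary oa) ob) (offN (off_boundary ob)) oa' ob' E.
Qed.

Lemma cycle_split a b : off a -> off b -> boundary (a + cone w b) = 0 ->
  boundary a = - b /\ boundary b = 0.
Proof.
move=> oa ob z0; have off0 : off 0 by move=> s; rewrite ffunE.
have := boundary_split_eq oa ob off0 off0; rewrite z0 linear0 addr0 => /(_ erefl)[].
by move/esym/eqP; rewrite addr_eq0 => /eqP -> /esym/eqP; rewrite oppr_eq0 => /eqP.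
Qed.

(** By [boundary_cone], [cone w] fills every cycle. *)
Lemma acyclic_apex : (forall s, s \in D -> w |: s \in D) -> acyclic K D.
Proof.
move=> wD; apply/acyclicP=> j z zC z0; exists (cone w z); last first.
  by rewrite boundary_cone z0 linear0 subr0.
apply/memv_chains=> s; rewrite ffunE; case: ifP; rewrite ?eqxx // => ws.
rewrite mulf_eq0 signr_eq0 /= => nz; have /memv_chains/(_ _ nz)[/wD] := zC.
by rewrite setD1K // => sD E; split=> //; rewrite (cardsD1 w) ws; lia.
Qed.

(** An explicit connecting isomorphism: a cycle [a + cone w b] is sent to [b], and a cycle [b] of
    the vertex link lifts by filling [- b] in the deletion. *)
Lemma rhomology_vlink j : acyclic K (deletion D w) ->
  (rhomology K D (j + 1) != 0%VS) = (rhomology K (vlink D w) j != 0%VS).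
Proof.
move=> /acyclicP acD; apply/rhomology_neq0P/rhomology_neq0P.
  case=> z [zC z0 nb]; have [a [b [aC bC E]]] := chain_split zC; subst z.
  have oa := off_deletion aC; have ob := off_vlink bC.
  have [da db] := cycle_split oa ob z0.
  exists b; split=> // b' b'C; apply/negP=> /eqP Eb.
  (* A filling [y] of the cycle [a + b'], corrected by [cone w b'], bounds [a + cone w b]. *)
  have abC : a + b' \in chains (deletion D w) (j + 1).
    by rewrite memvD // (chainsS vlink_sub).
  have [|y yC Ey] := acD _ _ abC; first by rewrite linearD /= da Eb addNr.
  have y'C : y - cone w b' \in chains D (j + 1 + 1).
    by rewrite memvB ?cone_chains // (chainsS deletion_sub).
  case/eqP: (nb _ y'C).
  by rewrite linearB /= boundary_cone Ey Eb opprB addrACA subrr addr0 addrC.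
case=> b [bC b0 nb]; have ob := off_vlink bC.
have [||a aC Ea] := acD j (- b); first by rewrite rpredN (chainsS vlink_sub).
  by rewrite linearN /= b0 oppr0.
have oa := off_deletion aC.
exists (a + cone w b); split.
- by rewrite memvD ?cone_chains // (chainsS deletion_sub).
- by rewrite boundary_split Ea b0 addNr linearN linear0 oppr0 addr0.
move=> y yC; apply/negP=> /eqP Ey; have [a' [b' [a'C b'C E]]] := chain_split yC; subst y.
have [_ Eb] := boundary_split_eq (off_deletion a'C) (off_vlink b'C) oa ob Ey.
have b''C : - b' \in chains (vlink D w) (j + 1) by rewrite rpredN.
by case/eqP: (nb _ b''C); rewrite linearN /= Eb.
Qed.

(** If [b'] fills [b] in the vertex link, [a + cone w b] is homologous to [a + b'], which avoids
    [w]. The same replacement turns a filling in [D] into one in the deletion. *)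
Lemma rhomology_deletion j : acyclic K (vlink D w) ->
  (rhomology K D j != 0%VS) = (rhomology K (deletion D w) j != 0%VS).
Proof.
rewrite -[j](subrK 1); move: (j - 1) => {}j.
move=> /acyclicP acL; apply/rhomology_neq0P/rhomology_neq0P.
  case=> z [zC z0 nb]; have [a [b [aC bC E]]] := chain_split zC; subst z.
  have [da db] := cycle_split (off_deletion aC) (off_vlink bC) z0.
  have [b' b'C Eb] := acL _ _ bC db.
  exists (a + b'); split=> [||y yC].
  - by rewrite memvD // (chainsS vlink_sub).
  - by rewrite linearD /= da Eb addNr.
  apply/negP=> /eqP Ey.
  have y'C : y - cone w b' \in chains D (j + 1 + 1).
    by rewrite memvB ?cone_chains // (chainsS deletion_sub).
  case/eqP: (nb _ y'C).
  by rewrite linearB /= boundary_cone Ey Eb opprB addrACA subrr addr0 addrC.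
case=> z [zC z0 nb]; exists z; split=> // [|y yC]; first exact: (chainsS deletion_sub).
apply/negP=> /eqP Ey; have [a [b [aC bC E]]] := chain_split yC; subst y.
have off0 : off 0 by move=> s; rewrite ffunE.
(* The cycle [z] is read as [z + cone w 0] to compare parts. *)
have [Ez Eb] := boundary_split_eq (off_deletion aC) (off_vlink bC) (off_deletion zC) off0
  (etrans Ey (esym (etrans (congr1 _ (linear0 _)) (addr0 _)))).
have [|b' b'C Eb'] := acL _ _ bC; first by apply/eqP; rewrite -oppr_eq0 -Eb.
have aC' : a + b' \in chains (deletion D w) (j + 1 + 1).
  by rewrite memvD // (chainsS vlink_sub).
by case/eqP: (nb _ aC'); rewrite linearD /= Eb' -Ez.
Qed.

(** The inclusion of the vertex link induces the isomorphism. A filling [a + cone w b] in [D] of a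
    cycle [z] of the deletion gives [z = boundary a + b] with [b] a link cycle; if [a] bounds a link
    cycle [b], filling the cycle [cone w b - a] shows that [b] bounds in the link. *)
Lemma rhomology_vlink_deletion j : acyclic K D ->
  (rhomology K (vlink D w) j != 0%VS) = (rhomology K (deletion D w) j != 0%VS).
Proof.
move=> /acyclicP acD; apply/rhomology_neq0P/rhomology_neq0P.
  case=> b [bC b0 nb]; exists b; split=> // [|a aC]; first exact: (chainsS vlink_sub).
  apply/negP=> /eqP Ea.
  have zC : cone w b - a \in chains D (j + 1).
    by rewrite memvB ?cone_chains // (chainsS deletion_sub).
  have [|y yC Ey] := acD _ _ zC.
    by rewrite linearB /= boundary_cone b0 linear0 subr0 Ea subrr.
  have [a' [b' [a'C b'C E]]] := chain_split yC; subst y.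
  rewrite [_ - a]addrC in Ey.
  have [_ Eb] := boundary_split_eq (off_deletion a'C) (off_vlink b'C)
     (offN (off_deletion aC)) (off_vlink bC) Ey.
  have b''C : - b' \in chains (vlink D w) (j + 1) by rewrite rpredN.
  by case/eqP: (nb _ b''C); rewrite linearN /= Eb.
case=> z [zC z0 nb].
have [y yC Ey] := acD _ _ (chainsS deletion_sub zC) z0.
have [a [b [aC bC E]]] := chain_split yC; subst y.
have off0 : off 0 by move=> s; rewrite ffunE.
have [Ez Eb] := boundary_split_eq (off_deletion aC) (off_vlink bC) (off_deletion zC) off0
  (etrans Ey (esym (etrans (congr1 _ (linear0 _)) (addr0 _)))).
exists b; split=> [//||b' b'C].
  by apply/eqP; rewrite -oppr_eq0 -Eb.
apply/negP=> /eqP Eb'.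
have aC' : a + b' \in chains (deletion D w) (j + 1).
  by rewrite memvD // (chainsS vlink_sub).
by case/eqP: (nb _ aC'); rewrite linearD /= Eb' -Ez.
Qed.

End VertexRemoval.

(** * Homology under order-preserving embeddings of vertex sets *)

Section OrderEmbedding.
Variables (K : fieldType) (V W : finType) (f : V -> W).
Hypothesis f_inj : injective f.
Hypothesis f_lt : forall x y,
  (enum_rank (f x) < enum_rank (f y))%N = (enum_rank x < enum_rank y)%N.
Implicit Types (s : {set V}) (t : {set W}) (D : {set {set V}}) (j : int).

(** Extension by zero. Signs depend only on the vertex order, which [f] preserves, so no sign
    correction is needed. *)
Definition push (c : chain_space K V) : chain_space K W :=
  [ffun t : {set W} => if t \subset [set f x | x : V] then c (f @^-1: t) else 0].

Lemma preimset_imset s : f @^-1: (f @: s) = s.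
Proof. by apply/setP=> x; rewrite inE (mem_imset _ _ f_inj). Qed.

Lemma imset_full s : f @: s \subset [set f x | x : V].
Proof. by apply/subsetP=> _ /imsetP[x _ ->]; rewrite imset_f. Qed.

Lemma imset_preimset t : t \subset [set f x | x : V] -> f @: (f @^-1: t) = t.
Proof.
move=> tf; apply/setP=> y; apply/imsetP/idP=> [[x]|yt]; first by rewrite inE => ? ->.
by have /imsetP[x _ E] := subsetP tf _ yt; exists x; rewrite // inE -E.
Qed.

Lemma pushE c s : push c (f @: s) = c s.
Proof. by rewrite ffunE preimset_imset imset_full. Qed.

Lemma push_inj : injective push.
Proof. by move=> c c' E; apply/ffunP=> s; rewrite -!pushE E. Qed.

Lemma push0 : push 0 = 0.
Proof. by apply/ffunP=> t; rewrite !ffunE; case: ifP. Qed.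

Lemma vpos_imset s x : vpos (f @: s) (f x) = vpos s x.
Proof.
rewrite /vpos -(card_imset _ f_inj); congr #|pred_of_set _|; apply/setP=> y.
rewrite inE; apply/andP/imsetP=> [[/imsetP[z zs ->]]|[z]].
  by rewrite f_lt => lt; exists z; rewrite // inE zs.
by rewrite inE => /andP[zs lt] ->; rewrite mem_imset // f_lt.
Qed.

Lemma boundary_push c : boundary K W (push c) = push (boundary K V c).
Proof.
apply/ffunP=> t; rewrite boundaryE [in RHS]ffunE; case: ifPn => tf; last first.
  rewrite big1 // => y _; rewrite ffunE ifN ?mulr0 //.
  by apply: contra tf; apply: subset_trans (subsetUr _ _).
have {tf}[s ->] : exists s, t = f @: s by exists (f @^-1: t); rewrite imset_preimset.
rewrite preimset_imset boundaryE.
rewrite (bigID (fun y => y \in [set f x | x : V])) /= [X in _ + X]big1 ?addr0; last first.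
  move=> y /andP[_ yf]; rewrite ffunE ifN ?mulr0 //.
  by apply: contra yf => /subsetP; apply; rewrite setU11.
under eq_bigl => y do rewrite andbC.
rewrite big_mkcondr big_imset /=; last by move=> x y _ _; exact: f_inj.
rewrite [RHS]big_mkcond /=; apply: eq_big => [x|x _]; first by rewrite inE.
by rewrite mem_imset // vpos_imset -imsetU1 pushE.
Qed.

Lemma push_chains D j c :
  (push c \in chains K [set f @: s | s : {set V} in D] j) = (c \in chains K D j).
Proof.
apply/memv_chains/memv_chains=> H.
  move=> s; rewrite -pushE => /H[]; rewrite card_imset // => /imsetP[s' s'D E].
  by rewrite -(preimset_imset s) E preimset_imset.
move=> t; rewrite ffunE; case: ifPn; rewrite ?eqxx // => tf /H[sD E].
by rewrite -(imset_preimset tf) imset_f // card_imset.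
Qed.

Lemma chains_imsetP D j c : c \in chains K [set f @: s | s : {set V} in D] j ->
  exists2 c', c' \in chains K D j & c = push c'.
Proof.
move=> cC; have E : c = push [ffun s : {set V} => c (f @: s)].
  apply/ffunP=> t; rewrite ffunE; case: (eqVneq (c t) 0) => [c0|nz].
    by case: ifP => // tf; rewrite ffunE imset_preimset.
  have /memv_chains/(_ _ nz)[/imsetP[s _ ->] _] := cC.
  by rewrite imset_full ffunE preimset_imset.
by exists [ffun s : {set V} => c (f @: s)]; rewrite -?push_chains -?E.
Qed.

Lemma rhomology_imset D j :
  (rhomology K [set f @: s | s : {set V} in D] j != 0%VS) = (rhomology K D j != 0%VS).
Proof.
apply/rhomology_neq0P/rhomology_neq0P=> -[z [zC z0 nb]].
  have [c cC Ez] := chains_imsetP zC; subst z; exists c; split=> // [|y yC].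
    by apply: push_inj; rewrite -boundary_push push0.
  have pyC : push y \in chains K [set f @: s | s : {set V} in D] (j + 1).
    by rewrite push_chains.
  by apply: contra (nb _ pyC) => /eqP <-; rewrite boundary_push.
exists (push z); split; rewrite ?push_chains ?boundary_push ?z0 ?push0 //.
move=> _ /chains_imsetP[y yC ->]; rewrite boundary_push (inj_eq push_inj); exact: nb.
Qed.

End OrderEmbedding.

(** The enumeration of a sum type lists the left summand first. *)
Lemma enum_rank_inl (A B : finType) (x : A) :
  enum_rank (inl x : A + B)%type = enum_rank x :> nat.
Proof.
have rankE (T : finType) (y : T) : enum_rank y = index y (enum T) :> nat.
  rewrite /enum_rank enum_rank_in.unlock insubdK //.
  by rewrite cardE [_ \in _]index_mem mem_enum.
rewrite !rankE [enum {: A + B}]enumT unlock /= /sum_enum.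
by rewrite index_cat map_f -?enumT ?mem_enum // index_map // => ? ? [].
Qed.

(** * Links restricted to a set of available vertices *)

Section Rel.
Variables (K : fieldType) (W : finType) (Phi : {set {set W}}).
Hypothesis Phi_down : down_closed Phi.
Implicit Types (F Z G : {set W}) (j : int).

(* Deletions and links of vertices of a [restr_link] are again of this form, so
   that inductions removing one vertex at a time stay inside this class. *)
Definition restr_link F Z : {set {set W}} := [set G : {set W} | (G \subset Z) && (G :|: F \in Phi)].

Lemma mem_restr_link F Z G :
  (G \in restr_link F Z) = (G \subset Z) && (G :|: F \in Phi).
Proof. by rewrite inE. Qed.

Lemma linkE F : link Phi F = restr_link F (~: F).
Proof.
apply/setP=> G; rewrite !inE setI_eq0 disjoints_subset.
apply/and3P/andP=> [[_ -> ->]|[-> GF]] //; split=> //.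
exact: Phi_down GF (subsetUl _ _).
Qed.

Lemma restr_link_down F Z : down_closed (restr_link F Z).
Proof.
move=> s t; rewrite !inE => /andP[tZ tP] st; rewrite (subset_trans st) //=.
exact: Phi_down tP (setSU _ st).
Qed.

Lemma deletion_restr_link F Z w : deletion (restr_link F Z) w = restr_link F (Z :\ w).
Proof. by apply/setP=> G; rewrite !inE subsetD1 -andbA [X in _ && X]andbC andbA. Qed.

Lemma vlink_restr_link F Z w : w \in Z ->
  vlink (restr_link F Z) w = restr_link (w |: F) (Z :\ w).
Proof.
move=> wZ; apply/setP=> G; rewrite !inE subsetD1 subUset sub1set wZ /= setUCA setUA.
by rewrite andbA [_ && (G \subset Z)]andbC.
Qed.

(** The family is empty, so all its chains vanish. This covers vertex links at vertices that do not
    extend a face. *)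
Lemma acyclic_void F Z : F \notin Phi -> acyclic K (restr_link F Z).
Proof.
move=> FP; apply/acyclicP=> j z zC _; exists 0; rewrite ?mem0v // linear0.
apply/ffunP=> s; rewrite ffunE; apply/esym/eqP; apply: contraNT FP.
move/memv_chains: zC => zC /zC[]; rewrite inE => /andP[_ sP] _.
exact: Phi_down sP (subsetUr _ _).
Qed.

End Rel.

(** * Links in [phi i D] *)

Section PhiLinks.
Variables (K : fieldType) (V : finType) (i : nat) (D : {set {set V}}).
Hypothesis D_down : down_closed D.
Local Notation NV := (new_vertex i D).
Local Notation W := (V + NV)%type.
Local Notation Phi := (phi i D).
Local Notation large s := (complex_dim D + 2 - i%:Z <= #|s|%:Z).
Implicit Types (F Z G : {set W}) (s : {set V}) (a : NV) (x : V) (j : int).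

(* The face written [(s, T)] above has [lpart F = s] and [rpart F = T]. *)
Definition lpart F : {set V} := [set x | inl x \in F].
Definition rpart F : {set NV} := [set a | inr a \in F].

Lemma card_part F : #|F| = (#|lpart F| + #|rpart F|)%N.
Proof.
rewrite -(card_imset (lpart F) (@inl_inj V NV)) -(card_imset (rpart F) (@inr_inj V NV)).
rewrite -cardsUI [X in (_ + X)%N](_ : _ = 0%N) ?addn0; last first.
  apply/eqP; rewrite cards_eq0; apply/eqP/setP=> y; rewrite !inE.
  by apply/negP=> /andP[/imsetP[x _ ->] /imsetP[]].
congr #|pred_of_set _|; apply/setP=> -[x|a]; rewrite !inE.
  rewrite (mem_imset _ _ (@inl_inj V NV)) inE; case: (_ \in F) => //=.
  by apply/esym/negP=> /imsetP[].
rewrite (mem_imset _ _ (@inr_inj V NV)) inE orbC; case: (_ \in F) => //=.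
by apply/esym/negP=> /imsetP[].
Qed.

Lemma mem_phi F : reflect
  [/\ lpart F \in D, (forall a, inr a \in F -> lpart F \subset val a) &
      (forall a b, inr a \in F -> inr b \in F -> (val a \subset val b) || (val b \subset val a))]
  (F \in Phi).
Proof.
rewrite inE; apply: (iffP exists_inP) => [[s sD /existsP[T]]|[lD sub chn]].
  case/and3P=> /forall_inP sT /forall_inP chT /eqP ->.
  set F' := _ :|: _.
  have El : lpart F' = s.
    apply/setP=> x; rewrite !inE (mem_imset _ _ (@inl_inj V NV)).
    by rewrite orbC; case: imsetP => [[]|].
  have Er a : (inr a \in F') = (a \in T).
    by rewrite !inE (mem_imset _ _ (@inr_inj V NV)); case: imsetP => [[]|].
  rewrite El; split=> // [a|a b]; rewrite !Er; first exact: sT.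
  by move=> /chT /forall_inP; apply.
exists (lpart F) => //; apply/existsP; exists (rpart F); apply/and3P; split.
- by apply/forall_inP=> a; rewrite inE; apply: sub.
- apply/forall_inP=> a; rewrite inE => aF; apply/forall_inP=> b; rewrite inE; exact: chn.
apply/eqP/setP=> -[x|a]; rewrite !inE.
  rewrite (mem_imset _ _ (@inl_inj V NV)) inE orbC.
  by case: imsetP => [[]|].
by rewrite (mem_imset _ _ (@inr_inj V NV)) inE; case: imsetP => [[]|].
Qed.

Lemma phi_down : down_closed Phi.
Proof.
move=> F G /mem_phi[lD sub chn] /subsetP FG.
have lFG : lpart F \subset lpart G by apply/subsetP=> x; rewrite !inE => /FG.
apply/mem_phi; split=> [|a /FG /sub|a b /FG aG /FG]; last exact: chn.
  exact: D_down lD lFG.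
exact: subset_trans.
Qed.

Lemma new_vertexP a : val a \in D /\ large (val a).
Proof. by case: a => s /= ; rewrite inE => /andP[]. Qed.

Lemma new_vertex_of s : s \in D -> large s -> exists a : NV, val a = s.
Proof.
move=> sD sl; have sS : s \in Sphi i D by rewrite inE sD.
by exists (Sub s sS).
Qed.

Lemma lpart_inr a F : lpart (inr a |: F) = lpart F.
Proof. by apply/setP=> x; rewrite !inE. Qed.

Lemma lpart_inrD a F : lpart (F :\ inr a) = lpart F.
Proof. by apply/setP=> x; rewrite !inE. Qed.

Lemma rpart_inrD a F : rpart (F :\ inr a) = rpart F :\ a.
Proof. by apply/setP=> b; rewrite !inE (inj_eq (@inr_inj V NV)). Qed.

Lemma lpart_inl x F : lpart (inl x |: F) = x |: lpart F.
Proof. by apply/setP=> y; rewrite !inE (inj_eq (@inl_inj V NV)). Qed.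

Lemma lpart_inlD x F : lpart (F :\ inl x) = lpart F :\ x.
Proof. by apply/setP=> y; rewrite !inE (inj_eq (@inl_inj V NV)). Qed.

Lemma least_new_vertex F : F \in Phi -> rpart F != set0 ->
  exists2 a, inr a \in F & forall b, inr b \in F -> val a \subset val b.
Proof.
case/mem_phi=> _ _ chn /set0Pn[a0 a0F].
case: (arg_minnP (fun a : NV => #|val a|) a0F) => a aF' min.
have aF : inr a \in F by have : a \in rpart F by []; rewrite inE.
exists a => // b bF; case/orP: (chn _ _ aF bF) => // ba.
have /eqP -> // : val b == val a.
by rewrite eqEcard ba; apply: min; rewrite -[_ b]/(b \in rpart F) inE.
Qed.

(** Induction on the new vertices in [Z]: the hypotheses pass to the vertex link and the deletion of
    each. When none is left, the least new vertex of [F] strictly contains [lpart F], and any extra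
    vertex [x] in it is an apex. *)
Lemma acyclic_restr_link_new F Z : rpart F != set0 -> lpart Z = ~: lpart F ->
  (forall a, inr a \in F :|: Z -> val a != lpart F) ->
  acyclic K (restr_link Phi F Z).
Proof.
have [n] := ubnP #|rpart Z|; elim: n F Z => // n IH F Z; rewrite ltnS => Zn F0 lZ neq.
have [FP|] := boolP (F \in Phi); last by apply: acyclic_void; exact: phi_down.
have [Z0|[a aZ]] := set_0Vmem (rpart Z).
  have [a aF amin] := least_new_vertex FP F0.
  case/mem_phi: FP => lD sub chn.
  have /subsetPn[x xa xF] : ~~ (val a \subset lpart F).
    apply: contra (neq a _); last by rewrite inE aF.
    by move=> sa; rewrite eqEsubset sa sub.
  apply: (@acyclic_apex _ _ _ (inl x)) => G; rewrite !mem_restr_link => /andP[GZ GF].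
  have xZ : inl x \in Z by rewrite inE in xF; move/setP/(_ x): lZ; rewrite !inE => ->.
  rewrite subUset sub1set xZ GZ /= -setUA.
  have rGF b : (inr b \in G :|: F) = (inr b \in F).
    rewrite inE; case: (boolP (_ \in G)) => // /(subsetP GZ) bZ.
    by move/setP/(_ b): Z0; rewrite !inE bZ.
  case/mem_phi: GF => lD' sub' chn'.
  have sx b : inr b \in F -> x |: lpart (G :|: F) \subset val b.
    by move=> bF; rewrite subUset sub1set (subsetP (amin b bF)) // sub' ?rGF.
  apply/mem_phi; split.
  - by rewrite lpart_inl; apply: D_down (sx _ aF); case: (new_vertexP a).
  - by move=> b; rewrite lpart_inl in_setU1 /= rGF; exact: sx.
  - by move=> b c; rewrite !in_setU1 /=; exact: chn'.
rewrite inE in aZ.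
have rD : (#|rpart (Z :\ inr a)| < n)%N.
  by move: Zn; rewrite rpart_inrD (cardsD1 a (rpart Z)) inE aZ.
move=> j; apply/eqP/negPn; rewrite (rhomology_deletion (w := inr a)).
- rewrite deletion_restr_link negbK; apply/eqP; apply: IH => //.
    by rewrite lpart_inrD.
  move=> b; rewrite !inE => bFZ; apply: neq; rewrite inE.
  by case/orP: bFZ => [->|/andP[_ ->]]; rewrite ?orbT.
- exact/restr_link_down/phi_down.
rewrite vlink_restr_link //; apply: IH => //.
- by apply/set0Pn; exists a; rewrite !inE eqxx.
- by rewrite lpart_inrD lpart_inr.
move=> b; rewrite lpart_inr !inE => bFZ; apply: neq; rewrite inE.
by move: bFZ; case: eqP => [[->]|_] /=; rewrite ?aZ ?orbT.
Qed.

(** New vertices in [Z] have acyclic vertex links and are deleted one by one; what remains is the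
    image of [link D (lpart F)] under [inl]. *)
Lemma rhomology_restr_link_face F Z j : rpart F = set0 -> lpart Z = ~: lpart F ->
  (forall a, inr a \in Z -> val a != lpart F) ->
  (rhomology K (restr_link Phi F Z) j != 0%VS) = (rhomology K (link D (lpart F)) j != 0%VS).
Proof.
have [n] := ubnP #|rpart Z|; elim: n F Z => // n IH F Z; rewrite ltnS => Zn F0 lZ neq.
have NF b : (inr b \in F) = false by move/setP/(_ b): F0; rewrite !inE.
have [Z0|[a aZ]] := set_0Vmem (rpart Z); last first.
  rewrite inE in aZ.
  have rD : (#|rpart (Z :\ inr a)| < n)%N.
    by move: Zn; rewrite rpart_inrD (cardsD1 a (rpart Z)) inE aZ.
  rewrite (rhomology_deletion (w := inr a)).
  - rewrite deletion_restr_link; apply: IH => //.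
      by rewrite lpart_inrD.
    by move=> b; rewrite !inE => /andP[_]; apply: neq.
  - exact/restr_link_down/phi_down.
  rewrite vlink_restr_link //; apply: acyclic_restr_link_new.
  - by apply/set0Pn; exists a; rewrite !inE eqxx.
  - by rewrite lpart_inrD lpart_inr.
  move=> b; rewrite lpart_inr !inE NF orbF => bZ; apply: neq.
  by case/orP: bZ => [/eqP[->]//|/andP[]].
have NZ b : (inr b \in Z) = false by move/setP/(_ b): Z0; rewrite !inE.
rewrite -(@rhomology_imset K _ _ (@inl V NV)); first last.
- by move=> x y; rewrite !enum_rank_inl.
- exact: inl_inj.
suff -> : restr_link Phi F Z = [set [set inl x | x in s] | s : {set V} in link D (lpart F)] by [].
apply/setP=> G; apply/idP/imsetP=> [|[s]].
  rewrite mem_restr_link => /andP[GZ /mem_phi[lD _ _]].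
  have lU : lpart (G :|: F) = lpart G :|: lpart F by apply/setP=> x; rewrite !inE.
  exists (lpart G).
    rewrite !inE setI_eq0 disjoints_subset -lZ -lU lD (D_down lD) ?lU ?subsetUl //= andbT.
    by apply/subsetP=> x; rewrite !inE; exact: (subsetP GZ).
  apply/setP=> -[x|b]; first by rewrite (mem_imset _ _ (@inl_inj V NV)) inE.
  have -> : (inr b \in G) = false by apply/negP=> /(subsetP GZ); rewrite NZ.
  by apply/esym/negP=> /imsetP[].
rewrite inE setI_eq0 disjoints_subset -lZ => /and3P[sD /subsetP sZ sFD] ->.
rewrite mem_restr_link; apply/andP; split.
  by apply/subsetP=> _ /imsetP[x /sZ xZ ->]; move: xZ; rewrite inE.
have NG b : (inr b \in [set inl x | x in s] :|: F) = false.
  by rewrite inE NF orbF; apply/negP=> /imsetP[].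
apply/mem_phi; split=> [|b|b c]; rewrite ?NG //.
suff -> : lpart ([set inl x | x in s] :|: F) = s :|: lpart F by [].
by apply/setP=> x; rewrite !inE (mem_imset _ _ (@inl_inj V NV)).
Qed.

(** Induction on the old vertices in [Z]. Deleting one shrinks [lpart F :|: lpart Z] and linking
    preserves it, so the last hypothesis persists. In the end it keeps the new vertex of [lpart F]
    out of [F]; lying below all other new vertices of a face, that vertex is an apex. *)
Lemma acyclic_restr_link_large F Z : large (lpart F) ->
  (forall a, (inr a \in Z) = (inr a \notin F)) ->
  (forall a, inr a \in F -> ~~ (val a \subset lpart F :|: lpart Z)) ->
  acyclic K (restr_link Phi F Z).
Proof.
have [n] := ubnP #|lpart Z|; elim: n F Z => // n IH F Z; rewrite ltnS => Zn lF rZ nsub.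
have [FP|] := boolP (F \in Phi); last by apply: acyclic_void; exact: phi_down.
have [Z0|[x xZ]] := set_0Vmem (lpart Z).
  case/mem_phi: FP => lD _ _; have [a Ea] := new_vertex_of lD lF.
  have aF : inr a \notin F.
    by apply/negP=> /nsub; rewrite Ea subsetUl.
  apply: (@acyclic_apex _ _ _ (inr a)) => G; rewrite !mem_restr_link => /andP[GZ GF].
  rewrite subUset sub1set rZ aF GZ /= -setUA.
  have El : lpart (G :|: F) = lpart F.
    apply/setP=> x; rewrite !inE; case: (boolP (_ \in G)) => // /(subsetP GZ) xZ.
    by move/setP/(_ x): Z0; rewrite !inE xZ.
  case/mem_phi: GF => lD' sub' chn'; apply/mem_phi.
  have sa b : inr b \in inr a |: (G :|: F) -> val a \subset val b.
    by rewrite inE => /orP[/set1P[->]//|/sub']; rewrite Ea El.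
  split=> [|b|b c].
  - by rewrite lpart_inr.
  - by rewrite lpart_inr El -Ea; exact: sa.
  move=> bG cG; move: (sa _ bG) (sa _ cG); move: bG cG.
  rewrite inE => /orP[/set1P[->]//|bG]; first by move=> _ _ ->.
  rewrite inE => /orP[/set1P[->]//|cG]; first by move=> ->; rewrite orbT.
  by move=> _ _; exact: chn'.
rewrite inE in xZ.
have lD : (#|lpart (Z :\ inl x)| < n)%N.
  by move: Zn; rewrite lpart_inlD (cardsD1 x (lpart Z)) inE xZ.
move=> j; apply/eqP/negPn; rewrite (rhomology_deletion (w := inl x)).
- rewrite deletion_restr_link negbK; apply/eqP; apply: IH => //.
    by move=> a; rewrite !inE /=; exact: rZ.
  move=> a /nsub; apply: contra => /subset_trans; apply; apply: setUS.
  by rewrite lpart_inlD subD1set.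
- exact/restr_link_down/phi_down.
rewrite vlink_restr_link //; apply: IH => //.
- rewrite lpart_inl; apply: le_trans lF _; rewrite lez_nat.
  by apply: subset_leq_card; apply: subsetUr.
- by move=> a; rewrite !inE /=; exact: rZ.
move=> a; rewrite in_setU1 /= => /nsub; apply: contra => /subset_trans; apply.
rewrite lpart_inl lpart_inlD; apply/subsetP=> y; rewrite !inE.
by case: (eqVneq y x) => [->|_] //=; rewrite xZ orbT.
Qed.

(** This link is the vertex link of [inr a] in the link of [F :\ inr a], which is acyclic; so the
    deletion of [inr a] computes it. *)
Lemma rhomology_link_new F a j : lpart F = val a -> rpart F = [set a] ->
  (rhomology K (link Phi F) j != 0%VS) = (rhomology K (link D (val a)) j != 0%VS).
Proof.
move=> lF rF; have aF : inr a \in F by move/setP/(_ a): rF; rewrite !inE eqxx.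
have rF0 : rpart (F :\ inr a) = set0 by rewrite rpart_inrD rF setDv.
have EZ : ~: F = ~: (F :\ inr a) :\ inr a.
  apply/setP=> y; rewrite !inE; by case: eqP => [->|]; rewrite ?aF.
rewrite linkE; last exact: phi_down.
rewrite EZ -{1}(setD1K aF) -vlink_restr_link ?inE ?eqxx //.
rewrite rhomology_vlink_deletion ?deletion_restr_link; first last.
- apply: acyclic_restr_link_large.
  + by rewrite lpart_inrD lF; case: (new_vertexP a).
  + by move=> b; rewrite inE.
  by move=> b bF; move/setP/(_ b): rF0; rewrite !inE in bF *; rewrite bF.
- exact/restr_link_down/phi_down.
rewrite rhomology_restr_link_face ?lpart_inrD ?lF //.
  by apply/setP=> x; rewrite -lF !inE.
move=> b; rewrite !inE => /andP[ba _]; apply: contra ba => /eqP/val_inj ->; exact: eqxx.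
Qed.

Lemma acyclic_link_new_small F : rpart F != set0 -> ~~ large (lpart F) ->
  acyclic K (link Phi F).
Proof.
move=> rF lF; rewrite linkE; last exact: phi_down.
apply: acyclic_restr_link_new => // [|a _].
  by apply/setP=> x; rewrite !inE.
by apply: contraNneq lF => <-; case: (new_vertexP a).
Qed.

Lemma acyclic_link_old_large F : rpart F = set0 -> large (lpart F) ->
  acyclic K (link Phi F).
Proof.
move=> rF lF; rewrite linkE; last exact: phi_down.
apply: acyclic_restr_link_large => // a; first by rewrite inE.
by move: rF => /setP/(_ a); rewrite !inE => ->.
Qed.

Lemma rhomology_link_old_small F j : rpart F = set0 -> ~~ large (lpart F) ->
  (rhomology K (link Phi F) j != 0%VS) = (rhomology K (link D (lpart F)) j != 0%VS).
Proof.
move=> rF lF; rewrite linkE; last exact: phi_down.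
apply: rhomology_restr_link_face => // [|a _].
  by apply/setP=> x; rewrite !inE.
by apply: contraNneq lF => <-; case: (new_vertexP a).
Qed.

(** Both moves keep [j + #|F|] and lower the number of new vertices in [F] plus old vertices outside
    [F]. They end at [rpart F = [set a]] with [val a = lpart F]. *)
Lemma rhomology_link_new_degree (n : int) F j :
  (forall s j', s \in D -> large s -> rhomology K (link D s) j' != 0%VS -> j' + 1 = n - #|s|%:Z) ->
  F \in Phi -> rpart F != set0 -> large (lpart F) ->
  rhomology K (link Phi F) j != 0%VS -> j = n - #|F|%:Z.
Proof.
move=> Hn; have [k] := ubnP (#|rpart F| + #|~: lpart F|)%N.
elim: k F j => // k IH F j; rewrite ltnS => Fk FP rF lF.
have [lD sub chn] := mem_phi _ FP.
have [a Ea] := new_vertex_of lD lF.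
have [aF|aF] := boolP (inr a \in F).
  have [rF1|rF1] := eqVneq (rpart F :\ a) set0.
    have rFa : rpart F = [set a] by rewrite -(setD1K (_ : a \in rpart F)) ?inE // rF1 setU0.
    rewrite (rhomology_link_new _ (esym Ea) rFa) => /Hn; rewrite Ea => /(_ lD lF).
    by rewrite card_part rFa cards1; lia.
  rewrite linkE; last exact: phi_down.
  have EZ : ~: F = ~: (F :\ inr a) :\ inr a.
    apply/setP=> y; rewrite !inE; by case: eqP => [->|]; rewrite ?aF.
  (* Deleting [inr a] from the link of [F :\ inr a] leaves an acyclic complex: [F] keeps a new
     vertex, and none in play equals [lpart F]. *)
  rewrite EZ -{1}(setD1K aF) -vlink_restr_link ?inE ?eqxx // -rhomology_vlink; first last.
  - rewrite deletion_restr_link; apply: acyclic_restr_link_new.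
    + by rewrite rpart_inrD.
    + by apply/setP=> x; rewrite !inE.
    move=> b; rewrite lpart_inrD -Ea (inj_eq val_inj) !inE.
    by rewrite (inj_eq (@inr_inj V NV)); case: (b == a).
  - exact/restr_link_down/phi_down.
  rewrite -linkE; last exact: phi_down.
  have F'P : F :\ inr a \in Phi by apply: phi_down FP _; rewrite subD1set.
  have := cardsD1 a (rpart F); rewrite inE aF => E1.
  have lt : (#|rpart (F :\ inr a)| + #|~: lpart (F :\ inr a)| < k)%N.
    by move: Fk; rewrite rpart_inrD lpart_inrD E1.
  rewrite -rpart_inrD in rF1; rewrite -(lpart_inrD a) in lF.
  move/(IH _ _ lt F'P rF1 lF) => E.
  by rewrite (cardsD1 (inr a) F) aF -(addrK 1 j) E -addrA -opprD -(PoszD _ 1) addn1.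
have [b bF bmin] := least_new_vertex FP rF.
have /subsetPn[x xb xF] : ~~ (val b \subset lpart F).
  apply: contra aF => sb; suff -> : a = b by [].
  by apply/val_inj/eqP; rewrite Ea eqEsubset sb sub.
have xF' : inl x \notin F by rewrite inE in xF.
have F'P : inl x |: F \in Phi.
  have sx c : inr c \in F -> x |: lpart F \subset val c.
    by move=> cF; rewrite subUset sub1set (subsetP (bmin _ cF)) // sub.
  apply/mem_phi; split=> [|c|c d]; rewrite ?lpart_inl.
  - by apply: D_down (sx _ bF); case: (new_vertexP b).
  - by rewrite in_setU1 /=; exact: sx.
  by rewrite !in_setU1 /=; exact: chn.
rewrite linkE; last exact: phi_down.
rewrite -[j](subrK 1) (rhomology_vlink (w := inl x)); first last.
- rewrite deletion_restr_link; apply: acyclic_restr_link_large => // c.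
    by rewrite !inE.
  (* The deleted [x] lies in every new vertex of [F] but is no longer available. *)
  move=> cF; apply/subsetPn; exists x; first exact: (subsetP (bmin _ cF)).
  by rewrite !inE (negPf xF') eqxx.
- exact/restr_link_down/phi_down.
rewrite vlink_restr_link ?inE //.
rewrite (_ : _ :\ _ = ~: (inl x |: F)); last by apply/setP=> y; rewrite !inE negb_or.
rewrite -linkE; last exact: phi_down.
have rE : rpart (inl x |: F) = rpart F by apply/setP=> c; rewrite !inE.
have Ec : #|~: lpart F| = #|~: (x |: lpart F)|.+1.
  by rewrite (cardsD1 x) inE xF add1n setCU setIC setDE.
have lt : (#|rpart (inl x |: F)| + #|~: lpart (inl x |: F)| < k)%N.
  by rewrite rE lpart_inl; lia.
rewrite -rE in rF.
have lF' : large (lpart (inl x |: F)) by rewrite lpart_inl cardsU1 xF; lia.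
by move/(IH _ _ lt F'P rF lF'); rewrite cardsU1 xF'; lia.
Qed.

End PhiLinks.

(** * Degree bounds and faces of maximal size *)

Section Dimension.
Variables (K : fieldType) (V : finType).
Implicit Types (D : {set {set V}}) (s t : {set V}) (j : int).

Lemma rhomology_neq0_face D j : rhomology K D j != 0%VS ->
  exists2 t, t \in D & #|t|%:Z = j + 1.
Proof.
case/rhomology_neq0P=> z [zC _ nb].
have /existsP[t zt] : [exists t, z t != 0].
  apply: contraT => /existsPn z0; have /eqP[] := nb 0 (mem0v _).
  by rewrite linear0; apply/ffunP=> t; rewrite ffunE; apply/esym/eqP/negPn/z0.
by have /memv_chains/(_ _ zt)[tD Et] := zC; exists t.
Qed.

Lemma card_face_le D s : s \in D -> #|s|%:Z <= complex_dim D + 1.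
Proof. by move=> sD; rewrite /complex_dim subrK lez_nat leq_bigmax_cond. Qed.

Lemma rhomology_link_le D s j : rhomology K (link D s) j != 0%VS ->
  #|s|%:Z + j <= complex_dim D.
Proof.
case/rhomology_neq0_face=> t; rewrite inE setI_eq0 => /and3P[_ dts tsD] Et.
have := card_face_le tsD.
by rewrite (_ : #|t :|: s| = (#|t| + #|s|)%N); [lia | apply/eqP; rewrite (leq_card_setU t s).2].
Qed.

(** A face of maximal size has only [set0] in its link. This later gives
    [sz 0 = complex_dim D + 1]. *)
Lemma link_facet_neq0 D : down_closed D -> D != set0 -> exists s,
  [/\ s \in D, #|s|%:Z = complex_dim D + 1 & rhomology K (link D s) (-1) != 0%VS].
Proof.
move=> dD D0; have [s sD sM] : {s | s \in D & \max_(s in D) #|s| = #|s|}%N.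
  by apply: eq_bigmax_cond; rewrite card_gt0.
exists s; split=> //; first by rewrite /complex_dim sM subrK.
apply/rhomology_neq0P; exists (basis_chain K set0); split.
- apply/memv_chains=> t; rewrite ffunE; case: (t =P set0) => [->|]; rewrite ?eqxx // => _.
  by rewrite inE set0I set0U eqxx sD (dD _ _ sD) ?sub0set // cards0.
- apply/ffunP=> t; rewrite boundaryE ffunE big1 // => x _; rewrite ffunE.
  rewrite (_ : _ == _ = false) ?mulr0 //; apply/negbTE/set0Pn; exists x; exact: setU11.
move=> y yC; suff -> : y = 0.
  rewrite linear0 eq_sym; apply/eqP=> /ffunP/(_ set0); rewrite !ffunE eqxx.
  by apply/eqP; rewrite oner_eq0.
apply/ffunP=> t; rewrite ffunE; apply/eqP/negPn/negP=> nz.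
have /memv_chains/(_ _ nz)[] := yC; rewrite inE setI_eq0 => /and3P[_ dts tsD] Et.
have := card_face_le tsD; rewrite /complex_dim subrK sM.
rewrite (_ : #|t :|: s| = (#|t| + #|s|)%N); last by apply/eqP; rewrite (leq_card_setU t s).2.
by move: Et; lia.
Qed.

End Dimension.

(** * The degree type of [phi i D] *)

Theorem theorem5p5 (K : fieldType) (V : finType) (D : {set {set V}})
    (p i : nat) (hi : (1 <= i <= p)%N)
    (ds : (p - i).-tuple int) (di : int) :
  PR_complex K D ->
  degree_type K D (ds ++ di :: nseq i.-1 1) ->
  PR_complex K (phi i D) /\
  degree_type K (phi i D) (ds ++ (di + 1) :: nseq i.-1 1).
Proof.
case/andP: hi => i_gt0 le_ip [[D0 D_down] _] [p' [sz [nzp max_p nz_sz Eds]]].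
have Ep : p' = p.
  have /(congr1 size) := Eds.
  by rewrite size_map size_rev size_iota size_cat /= size_nseq size_tuple; lia.
subst p'.
(* The list descends from [d_p], so position [n] holds [d_(p - n)]. *)
have Edeg n : (n < p)%N ->
    nth 0 (ds ++ di :: nseq i.-1 1) n = (sz (p - n).-1)%:Z - (sz (p - n)%N)%:Z.
  move=> np; rewrite Eds (nth_map 0%N) ?size_rev ?size_iota //.
  rewrite nth_rev size_iota // nth_iota ?subnS ?add1n; last lia.
  by congr (_ - _)%R; congr (Posz (sz _)); lia.
have step k : (k.+1 < i)%N -> (sz k.+1)%:Z = (sz k)%:Z - 1.
  move=> ki; have kp : (p - k.+1 < p)%N by lia.
  have := Edeg _ kp; rewrite nth_cat size_tuple.
  rewrite ltnNge (_ : (p - i <= p - k.+1)%N) /=; last lia.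
  rewrite (_ : (p - k.+1 - (p - i))%N = (i - k.+1).-1.+1); last lia.
  rewrite /= nth_nseq (_ : (_ < _)%N = true); last lia.
  rewrite subKn; last lia.
  by rewrite /=; lia.
have sz_lin k : (k < i)%N -> (sz k)%:Z = (sz 0%N)%:Z - k%:Z.
  by elim: k => [|k IH] ki; [lia | rewrite step // IH; lia].
have [s0 [s0D Es0 nz0]] : exists s, [/\ s \in D, #|s|%:Z = complex_dim D + 1
    & rhomology K (link D s) (-1) != 0%VS].
  by apply: link_facet_neq0 => //; apply/set0Pn; exists set0.
have dimE : complex_dim D = (sz 0%N)%:Z - 1.
  have [_ /(_ s0 s0D)] := nz_sz 0%N isT; rewrite sub0r => /(_ nz0); lia.
(* By [dimE] and [sz_lin] the threshold is [sz i.-1]. *)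
pose large (s : {set V}) := complex_dim D + 2 - i%:Z <= #|s|%:Z.
have nz_small s (q : nat) : s \in D -> ~~ large s ->
    rhomology K (link D s) (q%:Z - 1) != 0%VS -> [/\ (q <= p)%N, (i <= q)%N & #|s| = sz q].
  move=> sD sl nz; have qp := max_p _ _ sD nz.
  have [_ /(_ s sD nz) Es] := nz_sz q qp; split=> //.
  rewrite leqNgt; apply: contra sl => qi; have := sz_lin _ qi; rewrite /large dimE Es; lia.
have nz_large s (j : int) : s \in D -> large s ->
    rhomology K (link D s) j != 0%VS -> j + 1 = (sz 0%N)%:Z - #|s|%:Z.
  move=> sD; rewrite /large dimE => sl nz.
  have [t _ Et] := rhomology_neq0_face nz.
  have := rhomology_link_le nz; rewrite dimE => le_j.
  have Ej : j = #|t|%:Z - 1 by lia.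
  rewrite Ej in nz; have qp := max_p _ _ sD nz.
  have [_ /(_ s sD nz) Es] := nz_sz _ qp.
  (* The dimension bound gives [#|t| <= sz 0 - #|s|], and [s] is large; hence the size is in the
     linear range. *)
  have ti : (#|t| < i)%N by lia.
  have := sz_lin _ ti; lia.
pose sz' q := (sz q + (q < i))%N.
have main (F : {set V + new_vertex i D}) (q : nat) : F \in phi i D ->
    rhomology K (link (phi i D) F) (q%:Z - 1) != 0%VS -> (q <= p)%N /\ #|F| = sz' q.
  move=> FP nz; have /mem_phi[lD sub _] := FP; rewrite card_part /sz'.
  have [rF|rF] := eqVneq (rpart F) set0.
    have [lF|lF] := boolP (large (lpart F)).
      by move: nz; rewrite (acyclic_link_old_large K D_down rF lF) eqxx.
    move: nz; rewrite rhomology_link_old_small // rF cards0.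
    by case/(nz_small _ _ lD lF)=> qp iq ->; rewrite ltnNge iq.
  have [lF|lF] := boolP (large (lpart F)); last first.
    by move: nz; rewrite (acyclic_link_new_small K D_down rF lF) eqxx.
  have := rhomology_link_new_degree D_down nz_large FP rF lF nz.
  rewrite card_part => Eq; have := rF; rewrite -card_gt0 => r_gt0.
  (* Here [q = sz 0 + 1 - #|F|], while [F] has a large old part and at least one new vertex. *)
  have qi : (q < i)%N by move: lF; rewrite /large dimE; lia.
  rewrite qi; split; first lia.
  by have := sz_lin _ qi; lia.
have nz_exists k : (k <= p)%N -> exists2 F, F \in phi i D &
    rhomology K (link (phi i D) F) (k%:Z - 1) != 0%VS.
  move=> kp; have [[s sD nz] /(_ s sD) Es] := nz_sz k kp; have {}Es := Es nz.
  (* The witness is [s] with its own new vertex if [k < i], and [s] alone otherwise. *)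
  have [ki|ik] := ltnP k i.
    have sl : large s by rewrite /large dimE Es; have := sz_lin _ ki; lia.
    have [a Ea] := new_vertex_of sD sl.
    pose F : {set V + new_vertex i D} := inr a |: [set inl x | x in s].
    have lF : lpart F = val a.
      by apply/setP=> x; rewrite !inE (mem_imset _ _ (@inl_inj V _)) Ea.
    have rF : rpart F = [set a].
      apply/setP=> b; rewrite !inE (inj_eq (@inr_inj V _)).
      by case: imsetP => [[]|]; rewrite ?orbF.
    have inF b : inr b \in F -> b = a.
      by move=> bF; apply/set1P; rewrite -rF inE.
    exists F; last by rewrite (rhomology_link_new K D_down _ lF rF) Ea.
    apply/mem_phi; rewrite lF; split; first by rewrite Ea.
      by move=> b /inF ->.
    by move=> b c /inF -> /inF ->; rewrite subxx.
  have sl : ~~ large s.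
    by have := rhomology_link_le nz; rewrite /large dimE; lia.
  pose F : {set V + new_vertex i D} := [set inl x | x in s].
  have lF : lpart F = s.
    by apply/setP=> x; rewrite !inE (mem_imset _ _ (@inl_inj V _)).
  have inF b : (inr b \in F) = false by apply/negP=> /imsetP[].
  have rF : rpart F = set0 by apply/setP=> b; rewrite !inE.
  exists F; last by rewrite rhomology_link_old_small ?lF.
  by apply/mem_phi; rewrite lF; split=> [|b|b c] //; rewrite inF.
split; first split.
- split; last exact: phi_down.
  have E0 : lpart (set0 : {set V + new_vertex i D}) = set0 by apply/setP=> x; rewrite !inE.
  by apply/mem_phi; split=> [|a|a b]; rewrite ?E0 // inE.
- move=> j F G FP GP nzF nzG; have [t _ Et] := rhomology_neq0_face nzF.
  (* Nonzero homology forces [j >= -1], so [main] applies with [q = #|t|]. *)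
  have Ej : j = #|t|%:Z - 1 by lia.
  by rewrite Ej in nzF nzG; have [_ ->] := main _ _ FP nzF; have [_ ->] := main _ _ GP nzG.
exists p, sz'; split.
- exact: nz_exists.
- by move=> q F FP /(main _ _ FP)[].
- move=> k kp; split; first exact: nz_exists.
  by move=> F FP /(main _ _ FP)[].
apply: (@eq_from_nth _ 0) => [|n].
  by rewrite size_map size_rev size_iota size_cat /= size_nseq size_tuple; lia.
rewrite size_cat /= size_nseq size_tuple => n_lt; have np : (n < p)%N by lia.
rewrite (nth_map 0%N) ?size_rev ?size_iota // nth_rev size_iota // nth_iota; last lia.
rewrite (_ : (1 + (p - n.+1))%N = (p - n)%N); last lia.
(* Only position [p - i], that of [d_i], changes: [sz' i.-1] gains one and [sz' i] does not. *)
have -> : nth 0 (ds ++ di + 1 :: nseq i.-1 1) n =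
    nth 0 (ds ++ di :: nseq i.-1 1) n + (n == p - i)%N%:Z.
  rewrite !nth_cat size_tuple; case: ltnP => [lt|le].
    by rewrite ltn_eqF // addr0.
  case E: (n - (p - i))%N => [|m] /=; first by rewrite (_ : n == _) //; lia.
  by rewrite (_ : (n == _) = false) ?addr0 //; lia.
rewrite Edeg // /sz'; lia.
Qed.
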